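(* Let $n$ be a natural number and let $G$ be a bounded FC-nilpotent group of class $n$. Then $G$ is (nilpotent of class at most $2n$)-by-finite; that is, $G$ has a normal subgroup of finite index which is nilpotent of class at most $2n$.
   Context: Let $H$ be a group, $N$ a normal subgroup of $H$ and $g\in H$. Write $C_H(g/N)$ for the preimage in $H$ of the centralizer $C_{H/N}(gN)$ under the projection $H\to H/N$, i.e. $C_H(g/N)=\{h\in H : [g,h]\in N\}$. For a subgroup $K$ of $H$, the FC-centralizer of $H$ modulo $N$ in $K$ is $$\mathrm{FC}_K(H/N)=\{k\in K : [H:C_H(k/N)] \text{ is finite}\}.$$ It is called bounded if there exists a natural number $m$ such that $\mathrm{FC}_K(H/N)=\{k\in K : [H:C_H(k/N)]\le m\}$. A group $H$ is FC-nilpotent of class $n$ if there is a finite chain $\{1\}=H_0\le H_1\le\dots\le H_n=H$ of normal subgroups of $H$ such that $H_{i+1}\le \mathrm{FC}_H(H/H_i)$ for every $0\le i<n$. It is bounded FC-nilpotent of class $n$ if there is such a chain for which, additionally, each $\mathrm{FC}_{H_{i+1}}(H/H_i)$ ($0\le i<n$) is bounded. (Equivalently: for each $i<n$ there is a natural number $m_i$ with $[H:C_H(h/H_i)]\le m_i$ for all $h\in H_{i+1}$.) *)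

(* Defs.v *)
From HB Require Import structures.
From mathcomp Require Import all_boot.
From mathcomp Require Import boolp classical_sets functions cardinality.

Set Implicit Arguments.
Unset Strict Implicit.
Unset Printing Implicit Defensive.

Local Open Scope classical_set_scope.
Local Open Scope group_scope.

(* A group is a [groupType] G, possibly infinite; its subgroups are Prop-valued
   sets [A : set G].  [~ x, y] is x^-1 * y^-1 * x * y and x ^ y is
   y^-1 * x * y. *)

Definition subgroup (G : groupType) (A : set G) : Prop :=
  A 1 /\ forall x y, A x -> A y -> A (x / y).

Definition normal_subgroup (G : groupType) (A : set G) : Prop :=
  subgroup A /\ forall x y, A x -> A (x ^ y).

Definition lcosets (G : groupType) (A : set G) : set (set G) :=
  range (fun x : G => [set x * a | a in A]).

Definition finite_index (G : groupType) (A : set G) : Prop :=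
  finite_set (lcosets A).

Definition index_le (G : groupType) (A : set G) (m : nat) : Prop :=
  (lcosets A #<= `I_m)%card.

Definition generated (G : groupType) (A : set G) : set G :=
  smallest (@subgroup G) A.

Definition commutator_subgroup (G : groupType) (A B : set G) : set G :=
  generated [set [~ a, b] | a in A & b in B].

(* Indexed from 0: [lower_central A k] is the (k+1)-st term of the usual
   series, the one starting with A as its first term. *)
Fixpoint lower_central (G : groupType) (A : set G) (k : nat) : set G :=
  if k is k'.+1 then commutator_subgroup (lower_central A k') A else A.

Definition nilpotent_class_le (G : groupType) (A : set G) (c : nat) : Prop :=
  lower_central A c = [set 1].

(* C_G(g/N), with G the whole group. *)
Definition centralizer_mod (G : groupType) (N : set G) (g : G) : set G :=
  [set h | N [~ g, h]].

(* FC_K(G/N) *)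
Definition FC_centralizer (G : groupType) (K N : set G) : set G :=
  [set k | K k /\ finite_index (centralizer_mod N k)].

Definition FC_centralizer_bounded (G : groupType) (K N : set G) : Prop :=
  exists m : nat,
    FC_centralizer K N = [set k | K k /\ index_le (centralizer_mod N k) m].

(* Only the values C 0, ..., C n are meaningful. *)
Definition FC_series (G : groupType) (n : nat) (C : nat -> set G) : Prop :=
  [/\ C 0 = [set 1], C n = setT,
      forall i, (i <= n)%N -> normal_subgroup (C i),
      forall i, (i < n)%N -> C i `<=` C i.+1
    & forall i, (i < n)%N -> C i.+1 `<=` FC_centralizer setT (C i)].

Definition FC_nilpotent (G : groupType) (n : nat) : Prop :=
  exists C : nat -> set G, FC_series n C.

Definition bounded_FC_nilpotent (G : groupType) (n : nat) : Prop :=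
  exists C : nat -> set G, FC_series n C /\
    forall i, (i < n)%N -> FC_centralizer_bounded (C i.+1) (C i).

(* Main.v *)
(* Each factor of the series contributes two steps.  Let [K] be normal in [Q], with
   the [Q]-classes of elements of [K] of size at most [m]; then a subgroup [A] of
   finite index satisfies [[K, A], A] = 1.  By Neumann's covering lemma, the [g]
   whose centralizer has finite index in [K] form a subgroup [F] of finite index:
   given [m + 1] cosets g_i F, some k in [K] would avoid the centralizers of all
   g_i^-1 g_j and have [m + 1] conjugates.  The argument of Neumann's theorem on
   BFC-groups, applied to [K] and [F], shows that the commutators [x, a], for [x] in
   [K] and [a] in a subgroup of finite index, form a finite subset of [K].  This set
   has a centralizer of finite index.  Applying this to K = H_{i+1} / H_i for all
   [i] and intersecting gives [[H_{i+1}, N], N] <= H_i for a normal subgroup [N] of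
   finite index. *)

From HB Require Import structures.
Require Import Defs.
From mathcomp Require Import all_boot generic_quotient.
From mathcomp Require Import boolp classical_sets functions cardinality.

Set Implicit Arguments.
Unset Strict Implicit.
Unset Printing Implicit Defensive.

Local Open Scope classical_set_scope.
Local Open Scope group_scope.

(** * Closure properties of subgroups and of commuting elements *)

Section Subgroups.
Variable G : groupType.
Implicit Types (A B : set G) (x y : G).

Lemma subgroupM A x y : subgroup A -> A x -> A y -> A (x * y).
Proof.
move=> [A1 AV] Ax Ay; rewrite -[y]invgK; apply: (AV) => //.
by rewrite -[y^-1]mul1g; apply: AV.
Qed.

Lemma subgroupV A x : subgroup A -> A x -> A x^-1.
Proof. by move=> [A1 AV] Ax; rewrite -[x^-1]mul1g; apply: AV. Qed.

Lemma subgroup_generated A : subgroup (generated A).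
Proof.
split=> [B [[B1 _] _] //|x y Ax Ay B BA].
by case: (BA) => -[_ BV] _; apply: BV; [apply: Ax|apply: Ay].
Qed.

Lemma subgroup_commute y : subgroup [set x | commute x y].
Proof.
split=> [|x z /= xy zy]; first exact: commute_sym (commute1 y).
by apply/commute_sym/commuteM; [|apply: commuteV]; apply: commute_sym.
Qed.

Lemma subgroup_centralizer (s : seq G) :
  subgroup [set g | forall x, x \in s -> commute x g].
Proof.
split=> [x _|g h gs hs x xs]; first exact: commute1.
by apply: commuteM; [apply: gs|apply: commuteV; apply: hs].
Qed.

Lemma subgroupI A B : subgroup A -> subgroup B -> subgroup (A `&` B).
Proof.
move=> [A1 AV] [B1 BV]; split=> // x y [Ax Bx] [Ay By].
by split; [apply: AV|apply: BV].
Qed.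

Lemma commute_conjg x y : commute x y -> x ^ y = x.
Proof. by move=> /commgP/conjg_fixP. Qed.

Lemma mulVgV x y z : (z^-1 * x)^-1 * (z^-1 * y) = x^-1 * y.
Proof. by rewrite invgM invgK mulgA mulgK. Qed.

End Subgroups.

(** * Finite index and coverings by cosets *)

Section FiniteIndex.
Variable G : groupType.
Implicit Types (K A B : set G) (x y : G).

(* Finite index of [A] in [K], where [A] need not be a subset of [K]: the left
   cosets of [A] meeting [K] are separated by finitely many labels. *)
Definition finite_index_in K A : Prop :=
  exists (T : finType) (f : G -> T),
    forall x y, K x -> K y -> f x = f y -> A (x^-1 * y).

Lemma finite_index_inS K A B :
  (forall x, K x -> A x -> B x) -> subgroup K ->
  finite_index_in K A -> finite_index_in K B.
Proof.
move=> AB sK [T [f fA]]; exists T, f => x y Kx Ky /fA fxy.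
by apply: AB (fxy Kx Ky); apply: subgroupM => //; apply: subgroupV.
Qed.

Lemma finite_index_inI K A B :
  finite_index_in K A -> finite_index_in K B -> finite_index_in K (A `&` B).
Proof.
move=> [T [f fA]] [U [h hB]]; exists (T * U)%type, (fun x => (f x, h x)).
by move=> x y Kx Ky [/fA fxy /hB hxy]; split; [apply: fxy|apply: hxy].
Qed.

Lemma finite_index_in_bigI (I : eqType) (s : seq I) (F : I -> set G) K :
  (forall i, i \in s -> finite_index_in K (F i)) ->
  finite_index_in K [set x | forall i, i \in s -> F i x].
Proof.
elim: s => [|i s IHs] sF; first by exists unit, (fun=> tt) => x y _ _ _ i.
have [T [f fF]] : finite_index_in K (F i `&` [set x | forall j, j \in s -> F j x]).
  apply: finite_index_inI; first by apply: sF; rewrite mem_head.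
  by apply: IHs => j js; apply: sF; rewrite inE js orbT.
exists T, f => x y Kx Ky /fF-/(_ Kx Ky)[Fi Fs] j.
by rewrite inE => /orP[/eqP -> //|]; apply: Fs.
Qed.

Lemma finite_index_in_transversal K A : finite_index_in K A ->
  exists s : seq G, (forall t, t \in s -> K t) /\
    forall x, K x -> exists2 t, t \in s & A (t^-1 * x).
Proof.
move=> [T [f fA]].
have /choice[r rP] : forall c, exists t, (exists2 x, K x & f x = c) ->
    K t /\ f t = c.
  move=> c; have [[x Kx fx]|nK] := pselect (exists2 x, K x & f x = c).
    by exists x.
  (* Labels not attained on [K] get the junk value [1]; the filter below removes them. *)
  by exists 1 => /nK.
exists [seq r c | c <- enum T & `[< exists2 x, K x & f x = c >]]; split.
  by move=> _ /mapP[c + ->]; rewrite mem_filter => /andP[/asboolP/rP[]].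
move=> x Kx; have [Kr fr] := rP _ (ex_intro2 _ _ x Kx erefl).
exists (r (f x)); last exact: fA.
apply: map_f; rewrite mem_filter mem_enum andbT.
by apply/asboolP; exists x.
Qed.

Lemma transversal_finite_index_in K A (s : seq G) : subgroup A ->
  (forall x, K x -> exists2 t, t \in s & A (t^-1 * x)) -> finite_index_in K A.
Proof.
move=> sA sK; pose f x := find (fun t => `[< A (t^-1 * x) >]) s.
(* The successor allows [inord] even for empty [s]; on [K] the position found is below [size s], so
   [inord] preserves it. *)
exists 'I_(size s).+1, (fun x => inord (f x)) => x y Kx Ky.
have fs z : K z -> f z < size s.
  move=> /sK[t ts At]; rewrite -has_find; apply/hasP.
  by exists t => //; apply/asboolP.
have fP z : K z -> A ((nth 1 s (f z))^-1 * z).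
  by move=> /fs; rewrite -has_find => /(nth_find 1)/asboolP.
move=> /(congr1 val); rewrite /= !inordK ?ltnS ?(ltnW (fs _ _)) // => fxy.
rewrite -(mulVgV x y (nth 1 s (f x))).
by apply: subgroupM sA (subgroupV sA (fP _ Kx)) _; rewrite fxy; apply: fP.
Qed.

(* B. H. Neumann's covering lemma; one list [s] of translates serves all the
   subgroups, which lets it grow freely in the induction on [As]. *)
Lemma coset_cover K (As : seq (set G)) (s : seq G) : subgroup K ->
  (forall A, A \in As ->
    [/\ subgroup A, A `<=` K & ~ finite_index_in K A]) ->
  exists2 x, K x & forall A t, A \in As -> t \in s -> ~ A (t^-1 * x).
Proof.
move=> sK; elim: As s => [|A As IHA] s sAs; first by exists 1; [case: sK|].
have [sA AK nA] := sAs A (mem_head _ _).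
have [z Kz zA] : exists2 z, K z & forall t, t \in s -> ~ A (t^-1 * z).
  apply: contrapT => nz; apply: nA; apply: (transversal_finite_index_in (s := s) sA).
  move=> x Kx; apply: contrapT => nx; apply: nz; exists x => // t ts At.
  by apply: nx; exists t.
(* The extra translates anticipate the move from [x] to [z * (t^-1 * x)], which puts it in the coset
   z A, disjoint from every u A with u in [s]. *)
have [B BAs|x Kx xAs] := IHA (s ++ [seq t * (z^-1 * u) | t <- s, u <- s]).
  by apply: sAs; rewrite inE BAs orbT.
have [[t ts Atx]|xA] := pselect (exists2 t, t \in s & A (t^-1 * x)); last first.
  exists x => // B t; rewrite inE => /orP[/eqP->|BAs] ts.
    by move=> Atx; apply: xA; exists t.
  by apply: xAs => //; rewrite mem_cat ts.
exists (z * (t^-1 * x)); first by apply: subgroupM => //; apply: AK.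
move=> B u; rewrite inE => /orP[/eqP->|BAs] us Bu.
  apply: (zA u us); rewrite -[u^-1 * z](mulgK (t^-1 * x)).
  by apply: subgroupM sA _ (subgroupV sA Atx); rewrite -mulgA.
apply: (xAs B (t * (z^-1 * u))) => //.
  by rewrite mem_cat orbC; apply/orP; left; apply/allpairsP; exists (t, u).
by rewrite !invgM invgK -!mulgA.
Qed.

End FiniteIndex.

(** * Normal subgroups with conjugacy classes of bounded size *)

Section BoundedClasses.
Variables (G : groupType) (K : set G).
Hypotheses (sK : subgroup K) (nK : forall x y, K x -> K (x ^ y)).

Let F : set G := [set g | finite_index_in K [set k | commute k g]].

Lemma subgroup_FC : subgroup F.
Proof.
split=> [|g h Fg Fh].
  by exists unit, (fun=> tt) => x y _ _ _; apply: commute1.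
apply: finite_index_inS (finite_index_inI Fg Fh) => // x _ [xg xh].
by apply: commuteM => //; apply: commuteV.
Qed.

Lemma finite_index_FC (m : nat) :
  (forall k, K k -> exists f : G -> 'I_m,
     forall x y, f x = f y -> commute k (x^-1 * y)) ->
  finite_index_in setT F.
Proof.
move=> Km; apply: contrapT => infF.
(* As [F] has infinite index, elements in distinct left cosets of [F] can be picked one after
   another. *)
have [s ss sF] : exists2 s : seq G, size s = m.+1 &
    pairwise (fun y x => `[< ~ F (x^-1 * y) >]) s.
  elim: m.+1 => [|r [s ss sF]]; first by exists [::].
  have [y yF] : exists y, forall t, t \in s -> ~ F (t^-1 * y).
    apply: contrapT => ny; apply: infF.
    apply: (transversal_finite_index_in (s := s) subgroup_FC) => x _.
    apply: contrapT => nx; apply: ny; exists x => t ts Ft.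
    by apply: nx; exists t.
  exists (y :: s); first by rewrite /= ss.
  by rewrite /= sF andbT; apply/allP => t ts; apply/asboolP; apply: yF.
pose C g := K `&` [set k | commute k g].
pose Cs := [seq C g | g <- [seq x^-1 * y | x <- s, y <- s] & `[< ~ F g >]].
(* Each [C g] with g outside [F] has infinite index in [K]. The trivial translate suffices: [k]
   commutes with none of these g. *)
have [A|k Kk kC] := @coset_cover _ K Cs [:: 1] sK.
  move=> /mapP[g]; rewrite mem_filter => /andP[/asboolP Fg _] ->.
  split=> [|x []//|FC]; last by apply: Fg; apply: finite_index_inS FC => // x _ [].
  have [C1 CM] := subgroup_commute g.
  by split=> [|x y [Kx xg] [Ky yg]]; split; [case: sK| |apply: sK.2|apply: CM].
have [f fk] := Km k Kk.
have : uniq (map f s).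
  rewrite uniq_pairwise pairwise_map; apply/(pairwiseP 1) => i j si sj ij.
  have /asboolP nF := pairwiseP 1 sF i j si sj ij.
  apply/eqP => /esym/fk kc; apply: (kC (C ((nth 1 s j)^-1 * nth 1 s i)) 1).
  - apply/map_f; rewrite mem_filter; apply/andP; split; first exact/asboolP.
    by apply/allpairsP; exists (nth 1 s j, nth 1 s i); rewrite !mem_nth.
  - exact: mem_head.
  - by rewrite invg1 mul1g.
move=> /card_uniqP; rewrite size_map ss => cfs.
by have := max_card (mem (map f s)); rewrite cfs card_ord ltnn.
Qed.

(* Neumann's argument: let [k] have as many conjugates [k ^ g], [g] in [s], under
   [F] as possible.  If [d] commutes with [s], then the conjugates of [d * k] under
   [F] are the [d * k ^ g], so that [d ^ h * k ^ h] is one of them for all [h]. *)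
Lemma finite_commutators (m : nat) :
  (forall k, K k -> exists f : G -> 'I_m,
     forall x y, f x = f y -> commute k (x^-1 * y)) ->
  exists P : seq G, (forall p, p \in P -> K p) /\
    exists2 D : set G, finite_index_in K D &
      forall d g, K d -> D d -> F g -> [~ d, g] \in P.
Proof.
move=> Km; pose Q r := `[< exists k (s : seq G), [/\ K k, forall g, g \in s -> F g,
  uniq [seq k ^ g | g <- s] & size s = r] >].
have Q0 : exists r, Q r.
  by exists 0; apply/asboolP; exists 1, [::]; split=> //; case: sK.
have Qm r : Q r -> r <= m.
  move=> /asboolP[k [s [Kk _ us <-]]]; have [f fk] := Km k Kk.
  (* The inverse appears because [f] labels left cosets of the centralizer of [k], while conjugates
     of [k] correspond to right cosets. *)
  have uf : uniq [seq f g^-1 | g <- s].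
    have := us; rewrite !uniq_pairwise !pairwise_map.
    apply: sub_pairwise => x y /=; apply: contraNN => /eqP/fk.
    rewrite invgK => kxy; apply/eqP.
    by rewrite -[k ^ x](conjgKV y) -(conjgM k) (commute_conjg kxy).
  have := max_card (mem [seq f g^-1 | g <- s]).
  by rewrite (card_uniqP uf) card_ord size_map.
case: (ex_maxnP Q0 Qm) => r /asboolP[k [s [Kk sF us sr]]] rmax.
exists [seq k ^ a * (k ^ b)^-1 | a <- s, b <- s]; split.
  move=> _ /allpairsP[[a b] [_ _ ->]].
  by apply: subgroupM; [| |apply: subgroupV]; auto.
exists [set d | forall g, g \in s -> commute d g].
  by apply: finite_index_in_bigI => g /sF.
have conj_s d g : K d -> (forall h, h \in s -> commute d h) -> F g ->
    exists2 h, h \in s & (d * k) ^ g = d * k ^ h.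
  move=> Kd ds Fg.
  have ds' : {in s, forall h, (d * k) ^ h = d * k ^ h}.
    by move=> h hs; rewrite conjMg; congr (_ * _); apply/commute_conjg/ds.
  have udk : uniq [seq (d * k) ^ h | h <- s].
    have /eq_in_map -> := ds'.
    by rewrite (map_comp ( *%g d)) map_inj_uniq //; apply: mulgI.
  have [/mapP[h hs ->]|ng] := boolP ((d * k) ^ g \in [seq (d * k) ^ h | h <- s]).
    by exists h => //; apply: ds'.
  (* A conjugate outside the list would give [d * k] one conjugate too many for the maximality of
     [r]. *)
  suff /rmax : Q r.+1 by rewrite ltnn.
  apply/asboolP; exists (d * k), (g :: s); split.
  - exact: subgroupM.
  - by move=> h; rewrite inE => /orP[/eqP->|/sF].
  - by rewrite /= ng.
  - by rewrite /= sr.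
move=> d g Kd ds Fg; apply/allpairsP.
have [a sa dka] := conj_s d g Kd ds Fg.
(* The case d = 1 gives [k ^ g = k ^ b]; cancelling it in [d ^ g * k ^ g = d * k ^ a] leaves
   [[~ d, g] = k ^ a * (k ^ b)^-1]. *)
have [b sb] := conj_s 1 g (sK.1) (fun h _ => commute_sym (commute1 h)) Fg.
rewrite !mul1g => kb; exists (a, b); split=> //=.
by rewrite commgEl -kb; apply: (canRL (mulgK _)); rewrite -mulgA -conjMg dka mulKg.
Qed.

(** Write x = t d with t in a transversal [T] of [D]. If a in [F] commutes with [T], then [x, a] =
    [d, a] lies in the finite set [P]. Centralizing [T] and [P] costs only finite index, since both
    are finite subsets of [K]. *)
Lemma finite_index_centralizing (m : nat) :
  (forall k, K k -> exists f : G -> 'I_m,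
     forall x y, f x = f y -> commute k (x^-1 * y)) ->
  exists A : set G, [/\ subgroup A, finite_index_in setT A &
    forall x a b, K x -> A a -> A b -> [~ [~ x, a], b] = 1].
Proof.
move=> Km; have [P [PK [D fD DP]]] := finite_commutators Km.
have [T [TK DT]] := finite_index_in_transversal fD.
have fCs (S : seq G) : (forall k, k \in S -> K k) ->
    finite_index_in setT [set g | forall k, k \in S -> commute k g].
  move=> SK; apply: finite_index_in_bigI => k /SK/Km[f fk].
  by exists 'I_m, f => x y _ _ /fk.
exists (F `&` [set g | forall t, t \in T -> commute t g] `&`
        [set g | forall p, p \in P -> commute p g]); split.
- by do 2?apply: subgroupI; [apply: subgroup_FC| |]; apply: subgroup_centralizer.
- by do 2?apply: finite_index_inI; [apply: finite_index_FC Km|apply: fCs|apply: fCs].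
move=> x a b Kx [[Fa aT] _] [_ bP]; apply/eqP/commgP/bP.
have [t tT Dtx] := DT x Kx.
have -> : [~ x, a] = [~ t^-1 * x, a].
  by rewrite !commgEl conjMg conjVg (commute_conjg (aT t tT)) mulVgV.
by apply: DP => //; apply: subgroupM => //; apply: subgroupV => //; apply: TK.
Qed.

End BoundedClasses.

(** * The quotient group modulo a normal subgroup *)

Section Quotient.
Variables (G : groupType) (L : set G).

Definition left_congr (x y : G) : bool := `[< L (x^-1 * y) >].

Hypothesis nL : normal_subgroup L.

Let sL : subgroup L := nL.1.

Lemma left_congr_equiv : equiv_class_of left_congr.
Proof.
split=> [x|x y|y x z].
- by apply/asboolP; rewrite mulVg; case: sL.
- apply: asbool_equiv_eq; split=> /(subgroupV sL); by rewrite invgM invgK.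
- move=> /asboolP xy /asboolP yz; apply/asboolP.
  have -> : x^-1 * z = x^-1 * y * (y^-1 * z) by rewrite mulgA mulgK.
  exact: subgroupM.
Qed.

Canonical left_congr_rel := EquivRelPack left_congr_equiv.

(** A type with its own group structure, so that the results on bounded classes apply to it
    directly. *)
Definition quotient_group := {eq_quot left_congr_rel}%qT.

HB.instance Definition _ := Choice.on quotient_group.
HB.instance Definition _ := Quotient.on quotient_group.

Definition coset_class (x : G) : quotient_group := (\pi_quotient_group x)%qT.

Let oneQ := coset_class 1.
Let mulQ (a b : quotient_group) := coset_class (repr a * repr b).
Let invQ (a : quotient_group) := coset_class (repr a)^-1.

Lemma coset_classP x y : coset_class x = coset_class y <-> L (x^-1 * y).
Proof. by split=> [/eqmodP/asboolP //|Lxy]; apply/eqmodP/asboolP. Qed.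

Lemma repr_coset_class x : L (x^-1 * repr (coset_class x)).
Proof. by apply/coset_classP; rewrite /coset_class reprK. Qed.

Lemma coset_class_repr (a : quotient_group) : coset_class (repr a) = a.
Proof. exact: reprK. Qed.

Let coset_classM x y : coset_class (x * y) = mulQ (coset_class x) (coset_class y).
Proof.
apply/coset_classP; have [Lx Ly] := (repr_coset_class x, repr_coset_class y).
(* For representatives r of x and s of y, (x y)^-1 r s = (x^-1 r)^y (y^-1 s). *)
have := subgroupM sL (nL.2 _ y Lx) Ly.
by rewrite conjgE invgM !mulgA mulgK.
Qed.

Let coset_classV x : coset_class x^-1 = invQ (coset_class x).
Proof.
apply/coset_classP; have Lx := repr_coset_class x.
have := nL.2 _ (repr (coset_class x))^-1 (subgroupV sL Lx).
by rewrite conjgE !invgM !invgK !mulgA mulgV mul1g.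
Qed.

Let mulQA : associative mulQ.
Proof.
move=> a b c; rewrite -[a]coset_class_repr -[b]coset_class_repr -[c]coset_class_repr.
by rewrite -!coset_classM mulgA.
Qed.

Let mul1Q : left_id oneQ mulQ.
Proof. by move=> a; rewrite -[a]coset_class_repr -coset_classM mul1g. Qed.

Let mulQ1 : right_id oneQ mulQ.
Proof. by move=> a; rewrite -[a]coset_class_repr -coset_classM mulg1. Qed.

Let mulVQ : left_inverse oneQ invQ mulQ.
Proof.
by move=> a; rewrite -[a]coset_class_repr -coset_classV -coset_classM mulVg.
Qed.

Let mulQV : right_inverse oneQ invQ mulQ.
Proof.
by move=> a; rewrite -[a]coset_class_repr -coset_classV -coset_classM mulgV.
Qed.

HB.instance Definition _ := isGroup.Build quotient_group
  mulQA mul1Q mulQ1 mulVQ mulQV.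

HB.instance Definition _ := isUMagmaMorphism.Build G quotient_group coset_class
  (erefl, coset_classM).

Lemma coset_class_eq1 x : coset_class x = 1 <-> L x.
Proof.
split=> [x1|Lx].
  rewrite -[x]invgK -[x^-1]mulg1; apply: subgroupV sL _.
  by apply/coset_classP; rewrite x1.
by apply/(coset_classP x 1); rewrite mulg1; apply: subgroupV sL Lx.
Qed.

Lemma coset_class_commute x y :
  commute (coset_class x) (coset_class y) <-> L [~ x, y].
Proof.
by rewrite -coset_class_eq1 gmulfR; split=> [/commgP/eqP|/eqP/commgP].
Qed.

End Quotient.

(** * Indices, normal cores and the transfer from the quotient *)

Section Index.
Variable G : groupType.
Implicit Types (K L A : set G).

Lemma lcosets_eqP A x y : subgroup A ->
  [set x * a | a in A] = [set y * a | a in A] <-> A (x^-1 * y).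
Proof.
move=> sA; split=> [xy|Axy].
  have [a Aa <-] : [set x * a | a in A] y.
    by rewrite xy; exists 1; [case: sA|rewrite mulg1].
  by rewrite mulKg.
apply/seteqP; split=> _ [a Aa <-].
  exists ((x^-1 * y)^-1 * a); first by apply: subgroupM => //; apply: subgroupV.
  by rewrite invgM invgK !mulgA mulgV mul1g.
exists (x^-1 * y * a); first exact: subgroupM.
by rewrite !mulgA mulgV mul1g.
Qed.

Lemma index_le_labelling A m : subgroup A -> index_le A m ->
  exists f : G -> 'I_m, forall x y, f x = f y -> A (x^-1 * y).
Proof.
move=> sA /pcard_leP[h]; pose c x := [set x * a | a in A].
have hm x : h (c x) < m by apply: ('funS_h); exists x.
exists (fun x => Ordinal (hm x)) => x y [] hxy; apply/(lcosets_eqP _ _ sA).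
by apply: ('inj_h) hxy; rewrite inE; [exists x|exists y].
Qed.

Lemma finite_index_in_setT A : subgroup A -> finite_index_in setT A ->
  finite_index A.
Proof.
move=> sA [T [f fA]].
have /choice[r rP] c : exists t, (exists x, f x = c) -> f t = c.
  have [[x fx]|nx] := pselect (exists x, f x = c); first by exists x.
  by exists 1 => /nx.
apply: sub_finite_set (finite_image (fun c => [set r c * a | a in A]) _); last first.
  exact: (@finite_finset _ setT).
move=> _ [x _ <-]; exists (f x) => //; apply/lcosets_eqP => //.
by apply: fA => //; apply: rP; exists x.
Qed.

Definition core A : set G := [set g | forall x, A (g ^ x)].

Lemma core_normal A : subgroup A -> normal_subgroup (core A).
Proof.
move=> sA; split; [split=> [x|x y Ax Ay z]|move=> x y Ax z].
- by rewrite conj1g; case: sA.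
- by rewrite conjMg conjVg; apply: sA.2.
- by rewrite -conjgM.
Qed.

(* [g ^ x] lies in [A] as soon as [g ^ t] does, for [t] in the coset [x A]. *)
Lemma finite_index_core A : subgroup A -> finite_index_in setT A ->
  finite_index_in setT (core A).
Proof.
move=> sA fA; have [s [_ sP]] := finite_index_in_transversal fA.
have : finite_index_in setT [set g | forall t, t \in s -> A (g ^ t)].
  apply: (@finite_index_in_bigI _ _ _ (fun t => [set g | A (g ^ t)])) => t _.
  have [T [f fP]] := fA; exists T, (fun x => f (x ^ t)) => x y _ _ fxy.
  by rewrite /= conjMg conjVg; apply: fP.
apply: finite_index_inS => // g _ gs x; have [t ts Atx] := sP x I.
rewrite -(mulVKg t x) conjgM conjgE; apply: subgroupM => //.
  exact: subgroupV.
by apply: subgroupM => //; apply: gs.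
Qed.

Lemma subgroup_centralizer_mod L k : normal_subgroup L ->
  subgroup (centralizer_mod L k).
Proof.
move=> nL; split=> [|x y /(coset_class_commute nL) kx /(coset_class_commute nL) ky].
  by apply/(coset_class_commute nL); rewrite gmulf1; apply: commute1.
apply/(coset_class_commute nL); rewrite gmulfF.
by apply: commuteM => //; apply: commuteV.
Qed.

(** Lets commutator conditions modulo [L] be checked on generators. *)
Lemma subgroup_centralizing_mod L A : normal_subgroup L ->
  subgroup [set x | forall a, A a -> L [~ x, a]].
Proof.
move=> nL; split=> [a _|x y xA yA a Aa]; apply/(coset_class_commute nL).
  by rewrite gmulf1; apply: commute_sym (commute1 _).
rewrite gmulfF; have [_ CM] := subgroup_commute (coset_class nL a).
by apply: CM; apply/coset_class_commute; [apply: xA|apply: yA].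
Qed.

(** The image of [K] modulo [L] has bounded classes, so [finite_index_centralizing] applies there;
    [A] is the preimage of the subgroup it provides. *)
Lemma finite_index_centralizing_mod K L m :
  normal_subgroup K -> normal_subgroup L ->
  (forall k, K k -> index_le (centralizer_mod L k) m) ->
  exists A : set G, [/\ subgroup A, finite_index_in setT A &
    forall x a b, K x -> A a -> A b -> L [~ [~ x, a], b]].
Proof.
move=> nK nL Km.
have [|_ y [x Kx <-]|_ [k Kk <-]|A [sA [T [f fA]] KA]] :=
    @finite_index_centralizing _ (coset_class nL @` K) _ _ m.
- split=> [|_ _ [x Kx <-] [y Ky <-]].
    by exists 1; [case: nK.1|rewrite gmulf1].
  by exists (x / y); [apply: nK.1.2|rewrite gmulfF].
- exists (x ^ repr y); first exact: nK.2.
  by rewrite gmulfJ /= coset_class_repr.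
- have [f fk] := index_le_labelling (subgroup_centralizer_mod k nL) (Km k Kk).
  exists (fun y => f (repr y)) => x y /fk/(coset_class_commute nL).
  by rewrite gmulfM gmulfV /= !coset_class_repr.
exists (coset_class nL @^-1` A); split.
- split=> [|x y Ax Ay]; rewrite /preimage /= ?gmulf1 ?gmulfF; first exact: sA.1.
  exact: sA.2.
- exists T, (f \o coset_class nL) => x y _ _ fxy.
  by rewrite /preimage /= gmulfM gmulfV; apply: fA.
move=> x a b Kx Aa Ab; apply/(coset_class_eq1 nL); rewrite !gmulfR.
by apply: KA => //; exists x.
Qed.

End Index.

(** * Lower central series and the conclusion *)

Lemma lower_central_subgroup (G : groupType) (N : set G) k :
  subgroup N -> subgroup (lower_central N k).
Proof. by case: k => //= k _; apply: subgroup_generated. Qed.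

(** Reduction to generators is made twice, for the outer commutator and then for the inner one. *)
Lemma lower_central_step (G : groupType) (N L : set G) k :
  normal_subgroup L ->
  (forall x a b, lower_central N k x -> N a -> N b -> L [~ [~ x, a], b]) ->
  lower_central N k.+2 `<=` L.
Proof.
move=> nL LN; apply: smallest_sub; first exact: nL.1.
move=> _ [y Ny [b Nb <-]].
suff : lower_central N k.+1 `<=` [set y | forall b, N b -> L [~ y, b]] by apply.
apply: smallest_sub; first exact: subgroup_centralizing_mod.
by move=> _ [x Nx [a Na <-]] c Nc; apply: LN.
Qed.

Theorem theorem2p8 (G : groupType) (n : nat) :
  bounded_FC_nilpotent G n ->
  exists N : set G,
    [/\ normal_subgroup N, finite_index N & nilpotent_class_le N (2 * n)%N].
Proof.
move=> [C [[C0 Cn nC _ CFC] bC]].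
have /choice[A AP] : forall i, exists A : set G, i < n ->
    [/\ subgroup A, finite_index_in setT A &
    forall x a b, C i.+1 x -> A a -> A b -> C i [~ [~ x, a], b]].
  (* For i >= n, [setT] is a mere placeholder. *)
  move=> i; have [ltin|] := boolP (i < n); last by exists setT.
  have [m Cm] := bC i ltin.
  have [k Ck|B BP] :=
      @finite_index_centralizing_mod _ (C i.+1) (C i) m
        (nC _ ltin) (nC _ (ltnW ltin)).
    have : FC_centralizer (C i.+1) (C i) k by split=> //; case: (CFC i ltin k Ck).
    by rewrite Cm => -[].
  by exists B.
pose B := [set x | forall i, i \in iota 0 n -> A i x].
have sB : subgroup B.
  split=> [i|x y Bx By i in_i]; have := AP i; rewrite -[i < n](mem_iota 0 n).
    by move=> H /H[[]].
  by case=> // -[_ +] _ _; apply; [apply: Bx|apply: By].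
have fB : finite_index_in setT B.
  by apply: finite_index_in_bigI => i; rewrite mem_iota => /AP[].
have nN := core_normal sB; set N := core B in nN *.
have NA i x : i < n -> N x -> A i x.
  by move=> ltin Nx; rewrite -[x]conjg1; apply: Nx; rewrite mem_iota.
exists N; split=> //.
  exact: finite_index_in_setT nN.1 (finite_index_core sB fB).
(* Two commutator steps descend one level, from [C n] at j = 0 to the trivial [C 0] at j = n. As
   [lower_central] counts from 0, this is exactly class at most 2n. *)
have NC j : j <= n -> lower_central N (2 * j) `<=` C (n - j).
  elim: j => [_|j IHj ltjn]; first by rewrite subn0 Cn.
  have ltin : n - j.+1 < n by rewrite ltn_subrL (leq_ltn_trans _ ltjn).
  rewrite mulnS; apply: lower_central_step; first by apply/nC/ltnW.
  move=> x a b /(IHj (ltnW ltjn)); rewrite -(subnSK ltjn) => Cx Na Nb.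
  by have [_ _ CA] := AP _ ltin; apply: CA => //; apply: NA.
apply/seteqP; split=> x; first by move=> /(NC n (leqnn n)); rewrite subnn C0.
by move=> ->; apply: (lower_central_subgroup _ nN.1).1.
Qed.
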